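(* Consider the MC (Markov chain) network model with parameters $L=\mathcal{L}=1$ and $U=\mathcal{U}=\infty$ and normalized rate $\lambda>0$, in which each node has degree $1$ at its arrival (i.e. $p_1(0)=1$ and $p_k(0)=0$ for all $k\ne1$) and isolated nodes are excluded ($k^0=1$), started at time $0$ from two nodes joined by one edge. Then, as the observation time $\mathcal{T}\to\infty$, the model reduces to the power-law model: if $p_k(\mathcal{T})$ denotes the expected fraction, among all nodes present at time $\mathcal{T}$, of nodes having degree $k$, then for every $k\ge1$ the limit $p_k=\lim_{\mathcal{T}\to\infty}p_k(\mathcal{T})$ exists, and $(p_k)_{k\ge 1}$ is a power-law distribution, i.e. $\sum_{k\ge1}p_k=1$ and there are constants $C>0$ and $\alpha>1$ such that $$\lim_{k\to\infty}k^{\alpha}\,p_k=C .$$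
   Context: The MC model is a continuous-time growing random graph with parameters $L\le\mathcal{L}$ and $\mathcal{U}\le U$ and normalized rate $\lambda>0$. Let $k^0$ be the starting degree of nodes (here $k^0=1$). A node $i$ of current degree $k_i\ge k^0$ has modified degree $$\hat k_i=\begin{cases}L,& k^0\le k_i\le\mathcal{L},\\ k_i,&\mathcal{L}<k_i\le\mathcal{U},\\ U,&k_i>\mathcal{U}\end{cases}$$ (for $L=\mathcal{L}=1$ and $U=\mathcal{U}=\infty$ this means $\hat k_i=k_i$ for every node). Nodes arrive one at a time. Given the current graph, for each existing node $i$, at rate $\lambda\hat k_i$ (independently over $i$) a new node arrives and is joined by one edge to node $i$; thus when the network has $n$ nodes the total arrival rate is $\lambda S_n$ with $S_n=\sum_{i=1}^n\hat k_i$, and an arriving node attaches to node $i$ with probability $\hat k_i/S_n$. The new node then has degree $1$ and the degree of node $i$ increases by $1$. The numbers $p_k(0)$ denote the probabilities that a node has degree $k$ at its arrival. The process is observed at time $\mathcal{T}$. ''Power-law model'' means a network whose node-degree distribution is a power law, i.e. asymptotically proportional to $k^{-\alpha}$ for some exponent $\alpha$. *)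

(* Defs.v *)
From mathcomp Require Import all_boot all_order all_algebra.
From mathcomp Require Import all_classical all_reals all_analysis.
Set Implicit Arguments.
Unset Strict Implicit.
Unset Printing Implicit Defensive.
Import Order.TTheory GRing.Theory Num.Theory.
Import numFieldNormedType.Exports.
Local Open Scope classical_set_scope.
Local Open Scope ring_scope.

(* Nodes are the naturals below [num_nodes], numbered by order of arrival; an edge *)
(* is recorded once, as a pair of end points.                                 *)
Record graph := Graph { num_nodes : nat; edges : seq (nat * nat) }.

Definition degree (g : graph) (i : nat) : nat :=
  count (fun e => (e.1 == i) || (e.2 == i)) (edges g).

Definition single_edge : graph := Graph 2 [:: (0%N, 1%N)].

(* The arriving node gets the number [num_nodes g] and has degree 1 at arrival, so *)
(* that, starting from [single_edge], no node is ever isolated.               *)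
Definition attach (g : graph) (i : nat) : graph :=
  Graph (num_nodes g).+1 ((i, num_nodes g) :: edges g).

Definition degree_fraction (R : realType) (g : graph) (k : nat) : R :=
  (\sum_(i < num_nodes g) (degree g i == k))%N%:R / (num_nodes g)%:R.

Section MCModel.
Context {R : realType}.

(* [L <= L'] and [U' <= U] are the parameters written L, \mathcal{L} and      *)
(* \mathcal{U}, U; the last two may be infinite. When [U' = +oo] the last     *)
(* branch is never reached, so the value [fine +oo = 0] plays no role.        *)
Definition modified_degree (L L' : R) (U' U : \bar R) (k : nat) : R :=
  if k%:R <= L' then L
  else if (k%:R%:E <= U')%E then k%:R
  else fine U.

Definition arrival_rate (lambda L L' : R) (U' U : \bar R) (g : graph) (i : nat)
  : R := lambda * modified_degree L L' U' U (degree g i).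

Definition total_rate (lambda L L' : R) (U' U : \bar R) (g : graph) : R :=
  \sum_(i < num_nodes g) arrival_rate lambda L L' U' U g i.

Section Process.
Context d (Omega : measurableType d) (P : probability Omega R).
Variables (Y : nat -> Omega -> graph) (tau : nat -> {RV P >-> R}).

(* The first n arrivals produced the graphs g 0, ..., g n, and the waiting     *)
(* time before the (j+1)-st of them lies in B j.                              *)
Definition history (n : nat) (g : nat -> graph) (B : nat -> set R) : set Omega :=
  [set w | (forall j, (j <= n)%N -> Y j w = g j) /\
           (forall j, (j < n)%N -> B j (tau j w))].

(* Y n is the graph after n arrivals and tau n the waiting time for the next   *)
(* one. Given the past, tau n is exponential with the total rate as parameter *)
(* and, independently of tau n, the new node joins node i with probability    *)
(* arrival_rate i / total_rate: this is the jump chain and the holding times  *)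
(* of the continuous-time Markov chain that jumps from g to [attach g i] at   *)
(* rate [arrival_rate i], for each node i of g.                               *)
Record MC_process (lambda L L' : R) (U' U : \bar R) : Prop := MCProcess {
  MC_measurable : forall n g, measurable [set w | Y n w = g];
  MC_start : forall w, Y 0%N w = single_edge;
  MC_transition : forall n (g : nat -> graph) (B : nat -> set R) (i : nat),
    (forall j, measurable (B j)) -> (i < num_nodes (g n))%N ->
    P (history n g B `&`
       [set w | Y n.+1 w = attach (g n) i /\ B n (tau n w)]) =
    (P (history n g B) *
     (arrival_rate lambda L L' U' U (g n) i /
      total_rate lambda L L' U' U (g n))%:E *
     exponential_prob (total_rate lambda L L' U' U (g n)) (B n))%E
}.

Definition arrival_time (n : nat) (w : Omega) : R := \sum_(j < n) tau j w.

(* The index n is unique, except on a null set, provided that infinitely many *)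
(* arrivals do not accumulate in finite time.                                 *)
Definition graph_at (t : R) (w : Omega) : graph :=
  Y (xget 0%N [set n | arrival_time n w <= t < arrival_time n.+1 w]) w.

Definition expected_degree_fraction (k : nat) (t : R) : \bar R :=
  ('E_P[fun w => degree_fraction R (graph_at t w) k])%E.

End Process.

Definition power_law (p : nat -> R) : Prop :=
  ((fun n => \sum_(1 <= k < n) p k) @ \oo --> (1 : R)) /\
  exists C alpha : R, [/\ 0 < C, 1 < alpha &
    (fun k : nat => k%:R `^ alpha * p k) @ \oo --> C].

End MCModel.

(* Main.v *)
(**
  The graph with n arrivals is a tree with n + 1 edges, so its total arrival
  rate is 2 lambda (n + 1) whatever the tree is: the arrival times are
  independent of the graphs. The expected number e_n(k) of nodes of degree k
  after n arrivals satisfies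
    e_(n+1)(k) = (1 - k / (2n+2)) e_n(k) + (k-1) / (2n+2) e_n(k-1) + [k = 1],
  which (n+1) p_k solves exactly for p_k = 4 / (k (k+1) (k+2)); the difference
  of the two solutions stays bounded, so that e_n(k) / (n+2) tends to p_k.
  By independence the expected fraction at time t is an average of the numbers
  e_n(k) / (n+2) weighted by the law of the number of arrivals before t, and
  this number is almost surely finite and tends to infinity with t.
*)
Require Import Defs.
From mathcomp Require Import all_boot all_order all_algebra.
From mathcomp Require Import all_classical all_reals all_analysis.
From mathcomp Require Import measurable_realfun ring lra.
Set Implicit Arguments.
Unset Strict Implicit.
Unset Printing Implicit Defensive.
Import Order.TTheory GRing.Theory Num.Theory.
Import numFieldNormedType.Exports.
Local Open Scope classical_set_scope.
Local Open Scope ring_scope.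

(** * Random growth of trees *)

(* Holds for the graphs reachable by n arrivals; the last clause is the        *)
(* handshake lemma for a tree with n + 1 edges.                                *)
Definition grown_tree (n : nat) (g : graph) : Prop :=
  [/\ num_nodes g = n.+2,
      forall i, (n.+2 <= i)%N -> degree g i = 0%N,
      forall i, (i < n.+2)%N -> (0 < degree g i)%N &
      (\sum_(i < n.+2) degree g i = n.+1.*2)%N].

Lemma degree_attach (g : graph) (i j : nat) :
  degree (attach g i) j = (((i == j) || (num_nodes g == j)) + degree g j)%N.
Proof. by []. Qed.

Lemma grown_tree_single_edge : grown_tree 0 single_edge.
Proof.
split => //.
- by move=> [|[|i]].
- by move=> [|[|i]].
- by rewrite !big_ord_recl big_ord0.
Qed.

Lemma grown_tree_attach (n : nat) (g : graph) (i : nat) :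
  grown_tree n g -> (i < num_nodes g)%N -> grown_tree n.+1 (attach g i).
Proof.
move=> [N d0 d1 ds]; rewrite N => ilt.
have degE j : degree (attach g i) j = (((i == j) || (n.+2 == j)) + degree g j)%N.
  by rewrite degree_attach N.
split.
- by rewrite /= N.
- move=> j jn; rewrite degE d0; last exact: ltnW.
  by rewrite !ltn_eqF// (leq_trans ilt)// ltnW.
- move=> j jn; rewrite degE; have [_|nj] := eqVneq n.+2 j; first by rewrite orbT.
  by rewrite ltn_addl// d1// ltn_neqAle eq_sym nj -ltnS.
- rewrite big_ord_recr/= degE eqxx orbT d0// addn0.
  under eq_bigr => j _ do rewrite degE (gtn_eqF (ltn_ord j)) orbF.
  rewrite big_split/= ds (bigD1 (Ordinal ilt))//= eqxx big1 ?addn0.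
    by rewrite addnC addnA addn1.
  by move=> j ji; rewrite (_ : (i == j) = false)//; apply/negbTE; rewrite eq_sym.
Qed.

(** * Transition probabilities of the jump chain *)

Section GrowthStep.
Context {R : realType}.
Variable lambda : R.
Hypothesis lambda_gt0 : 0 < lambda.

Local Notation rate := (arrival_rate lambda 1 1 +oo%E +oo%E).
Local Notation trate := (total_rate lambda 1 1 +oo%E +oo%E).

Definition holding_rate (n : nat) : R := 2 * lambda * n.+1%:R.

Lemma holding_rate_gt0 n : 0 < holding_rate n.
Proof. by rewrite /holding_rate !mulr_gt0. Qed.

(** Positivity of degrees in a grown tree matters: a node of degree 0 would also get modified degree
    1. *)
Lemma arrival_rateE n g i : grown_tree n g -> (i < n.+2)%N ->
  rate g i = lambda * (degree g i)%:R.
Proof.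
move=> [_ _ d1 _] /d1 di; rewrite /arrival_rate /modified_degree leey.
case: ifP => //; rewrite lern1 => di1; congr (_ * _).
by rewrite (_ : degree g i = 1%N)//; apply/eqP; rewrite eqn_leq di1.
Qed.

Lemma total_rateE n g : grown_tree n g -> trate g = holding_rate n.
Proof.
move=> gn; have [N _ _ ds] := gn; rewrite /total_rate N.
rewrite (eq_bigr (fun i : 'I__ => lambda * (degree g i)%:R)); last first.
  by move=> i _; rewrite (arrival_rateE gn).
by rewrite -mulr_sumr -natr_sum ds -mul2n natrM /holding_rate; ring.
Qed.

Lemma attach_probE n g i : grown_tree n g -> (i < n.+2)%N ->
  rate g i / trate g = (degree g i)%:R / (2 * n.+1%:R).
Proof.
move=> gn ni; rewrite (arrival_rateE gn)// (total_rateE gn) /holding_rate.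
by field; rewrite nat1r pnatr_eq0 lt0r_neq0.
Qed.

Lemma sum_attach_prob n g : grown_tree n g ->
  \sum_(i < num_nodes g) rate g i / trate g = 1.
Proof.
move=> gn; have [N _ _ ds] := gn; rewrite N.
rewrite (eq_bigr (fun i : 'I__ => (degree g i)%:R / (2 * n.+1%:R))); last first.
  by move=> i _; rewrite (attach_probE gn).
by rewrite -mulr_suml -natr_sum ds -mul2n natrM divff.
Qed.

(** The transition operator of the jump chain: the mean of [F] at the next graph, given the present
    graph [g]. Its m-th iterate is the mean of [F] after m further arrivals. *)
Definition growth_step (F : graph -> R) (g : graph) : R :=
  \sum_(i < num_nodes g) rate g i / trate g * F (attach g i).

Lemma growth_step_sum (I : finType) (F : I -> graph -> R) (m : nat) (g : graph) :
  iter m growth_step (fun h => \sum_i F i h) g =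
  \sum_i iter m growth_step (F i) g.
Proof.
elim: m g => //= m IH g; rewrite /growth_step exchange_big/=.
by apply: eq_bigr => i _; rewrite IH mulr_sumr.
Qed.

(** Only graphs reachable in [m] arrivals are visited, so identities that hold for trees alone can
    be used under the iterated operator. *)
Lemma eq_growth_step n m (F F' : graph -> R) :
  (forall g, grown_tree (n + m)%N g -> F g = F' g) ->
  forall g, grown_tree n g -> iter m growth_step F g = iter m growth_step F' g.
Proof.
elim: m n => [|m IH] n FF' g gn /=; first by apply: FF'; rewrite addn0.
apply: eq_bigr => i _; congr (_ * _); apply: (IH n.+1).
  by move=> h; rewrite addSnnS; exact: FF'.
exact: grown_tree_attach.
Qed.

Lemma growth_step_cst n m (c : R) g :
  grown_tree n g -> iter m growth_step (fun=> c) g = c.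
Proof.
elim: m n g => //= m IH n g gn; rewrite {1}/growth_step.
transitivity ((\sum_(i < num_nodes g) rate g i / trate g) * c); last first.
  by rewrite (sum_attach_prob gn) mul1r.
rewrite mulr_suml; apply: eq_bigr => i _.
by rewrite (IH n.+1)//; exact: grown_tree_attach.
Qed.

(** The constant [c] survives each step because attachment probabilities sum to 1 at every tree
    visited. *)
Lemma growth_step_affine n m (F1 F2 : graph -> R) (a b c : R) g :
  grown_tree n g ->
  iter m growth_step (fun h => a * F1 h + b * F2 h + c) g =
  a * iter m growth_step F1 g + b * iter m growth_step F2 g + c.
Proof.
elim: m n g => //= m IH n g gn; rewrite {1}/growth_step.
transitivity (a * growth_step (iter m growth_step F1) g +
    b * growth_step (iter m growth_step F2) g +
    (\sum_(i < num_nodes g) rate g i / trate g) * c); last first.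
  by rewrite (sum_attach_prob gn) mul1r.
rewrite mulr_suml !mulr_sumr -!big_split/=.
apply: eq_bigr => i _; rewrite (IH n.+1); first by ring.
exact: grown_tree_attach.
Qed.

(** * Mean degree counts *)

Definition degree_count (k : nat) (g : graph) : R :=
  (\sum_(i < num_nodes g) (degree g i == k))%N%:R.

Lemma degree_countE n k g : grown_tree n g ->
  degree_count k g = \sum_(i < n.+2) (degree g i == k)%:R.
Proof. by move=> [N _ _ _]; rewrite /degree_count N natr_sum. Qed.

(** An arrival affects only two nodes: [i] leaves its degree class for the next one, and the
    newcomer enters class 1. *)
Lemma degree_count_attach n k g i : grown_tree n g -> (i < n.+2)%N ->
  degree_count k.+1 (attach g i) = degree_count k.+1 g + (k == 0%N)%:R
    + (degree g i == k)%:R - (degree g i == k.+1)%:R.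
Proof.
move=> gn ni; have [N d0 d1 ds] := gn.
rewrite (degree_countE _ (grown_tree_attach gn _)) ?N//.
rewrite (degree_countE _ gn) big_ord_recr/= degree_attach N eqxx orbT d0// addn0.
rewrite (eq_bigr (fun j : 'I_n.+2 =>
  ((i == j) + degree g j == k.+1)%N%:R)); last first.
  by move=> j _; rewrite degree_attach N (gtn_eqF (ltn_ord j)) orbF.
rewrite (bigD1 (Ordinal ni))//= [in RHS](bigD1 (Ordinal ni))//=.
rewrite eqxx add1n eqSS.
rewrite (eq_bigr (fun j : 'I_n.+2 => (degree g j == k.+1)%N%:R)); last first.
  move=> j ji; rewrite (_ : (i == j) = false)//.
  by apply/negbTE; rewrite eq_sym.
by rewrite eqSS (eq_sym 0%N); ring.
Qed.

(** A node of degree l is chosen with probability l / (2n + 2), so the class of degree l loses a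
    node with l / (2n + 2) times its size as probability. *)
Lemma growth_step_degree_count n k g : grown_tree n g ->
  growth_step (degree_count k.+1) g =
  (1 - k.+1%:R / (2 * n.+1%:R)) * degree_count k.+1 g
  + k%:R / (2 * n.+1%:R) * degree_count k g + (k == 0%N)%:R.
Proof.
move=> gn; have [N d0 d1 ds] := gn; rewrite /growth_step.
under eq_bigr => i _ do
  rewrite (degree_count_attach _ gn) -?N// -!addrA
    (addrA (degree_count _ _)) mulrDr.
rewrite big_split/= -mulr_suml (sum_attach_prob gn) mul1r N.
have sum_deg l : \sum_(i < n.+2) rate g i / trate g * (degree g i == l)%:R =
    l%:R / (2 * n.+1%:R) * degree_count l g.
  rewrite (degree_countE _ gn) mulr_sumr; apply: eq_bigr => i _.
  rewrite (attach_probE gn)//; have [->//|] := eqVneq (degree g i) l.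
  by rewrite !mulr0.
under eq_bigr => i _ do rewrite mulrDr mulrN.
by rewrite big_split/= sumrN !sum_deg; ring.
Qed.

Lemma iter_growth_step_degree_count n k :
  iter n.+1 growth_step (degree_count k.+1) single_edge =
  (1 - k.+1%:R / (2 * n.+1%:R)) *
    iter n growth_step (degree_count k.+1) single_edge
  + k%:R / (2 * n.+1%:R) * iter n growth_step (degree_count k) single_edge
  + (k == 0%N)%:R.
Proof.
(* [iterSr] isolates the last arrival, the step applied first to the function. Its coefficients
   depend only on [n], hence commute with the earlier steps. *)
rewrite iterSr -(growth_step_affine _ _ _ _ _ _ grown_tree_single_edge).
apply: (eq_growth_step _ grown_tree_single_edge) => g.
exact: growth_step_degree_count.
Qed.

End GrowthStep.

(** * The recurrence for the expected degree counts *)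

Lemma cvg_harmonic_le {R : realType} (u : nat -> R) (l C : R) :
  (forall n, `|u n - l| <= C * n.+1%:R^-1) -> u @ \oo --> l.
Proof.
move=> uC; apply/cvgrPdistC_le => eps eps0.
have C0 : C * n.+1%:R^-1 @[n --> \oo] --> 0.
  by rewrite -[0](mulr0 C); apply: cvgMl_tmp; exact: cvg_harmonic.
near=> n; rewrite (le_trans (uC n))//.
by near: n; exact: cvgr_le C0 _ eps0.
Unshelve. all: by end_near. Qed.

Section DegreeRecurrence.
Context {R : realType}.

(** The Yule-Simon law of parameter 2. At 0 the inverse of zero gives the value 0. *)
Definition degree_law (k : nat) : R := 4 / (k%:R * k.+1%:R * k.+2%:R).

(** This is what the recurrence says of (n + 1) p_k once [n] has cancelled. *)
Lemma degree_law_rec k :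
  k.+3%:R * degree_law k.+1 = k%:R * degree_law k + 2 * (k == 0%N)%:R.
Proof.
rewrite /degree_law; case: k => [|k] /=.
  by rewrite !mul0r add0r mulr1; field.
have k0 : (k%:R : R) >= 0 by [].
by rewrite -!natr1; field; rewrite !lt0r_neq0//; lra.
Qed.

Variable e : nat -> nat -> R.
Hypothesis e_rec : forall n k, e n.+1 k.+1 =
  (1 - k.+1%:R / (2 * n.+1%:R)) * e n k.+1 + k%:R / (2 * n.+1%:R) * e n k
  + (k == 0%N)%:R.

(* (n + 1) p_k solves the recurrence exactly, so the error solves the          *)
(* homogeneous one, which is a contraction as soon as n >= k.                  *)
Let error n k := e n k - degree_law k * n.+1%:R.

Let error_rec n k : error n.+1 k.+1 =
  (1 - k.+1%:R / (2 * n.+1%:R)) * error n k.+1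
  + k%:R / (2 * n.+1%:R) * error n k.
Proof.
rewrite /error e_rec; have := degree_law_rec k.
set p := degree_law k; set q := degree_law k.+1; set b := (k == _)%:R => pq.
have -> : b = (k.+3%:R * q - k%:R * p) / 2 by rewrite pq; field.
have n0 : (n%:R : R) >= 0 by [].
by rewrite -!natr1; field; rewrite lt0r_neq0//; lra.
Qed.

(** Induction on [k]. The weight [k] is the factor of [error n k] in the recurrence, and it makes
    the case 0 trivial although nothing is known of [e n 0]. *)
Let error_bounded k : exists C, forall n, k%:R * `|error n k| <= C.
Proof.
elim: k => [|k [C IH]]; first by exists 0 => n; rewrite mul0r.
(* The sum covers the indices up to [k], where the coefficient of [error n k.+1] may be negative. *)
pose M := C + \sum_(j < k.+1) `|error j k.+1|.
have C0 : 0 <= C by rewrite (le_trans _ (IH 0%N))// mulr_ge0.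
have S0 : 0 <= \sum_(j < k.+1) `|error j k.+1| by exact: sumr_ge0.
have CM : C <= M by rewrite lerDl.
have small n : (n <= k)%N -> `|error n k.+1| <= M.
  move=> nk; rewrite -ltnS in nk.
  rewrite /M (bigD1 (Ordinal nk))//= addrCA lerDl addr_ge0//.
  exact: sumr_ge0.
exists (k.+1%:R * M) => n; rewrite ler_wpM2l//.
have [/small//|] := leqP n k.
elim: n => // n IHn; rewrite ltnS => kn.
have {}IHn : `|error n k.+1| <= M.
  by move: kn; rewrite leq_eqVlt => /predU1P[<-|/IHn//]; exact: small.
have N0 : (0 : R) < 2 * n.+1%:R by rewrite mulr_gt0.
have kN : k.+1%:R <= 2 * n.+1%:R :> R.
  by rewrite -natrM ler_nat (leq_trans (_ : _ <= n.+1)%N)// leq_pmull.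
have c0 : 0 <= 1 - k.+1%:R / (2 * n.+1%:R) :> R.
  by rewrite subr_ge0 ler_pdivrMr// mul1r.
rewrite error_rec (le_trans (ler_normD _ _))//.
rewrite (normrM (1 - _)) (ger0_norm c0) (normrM (k%:R / _)).
rewrite [X in _ + X * _]ger0_norm ?divr_ge0//.
have -> : k%:R / (2 * n.+1%:R) * `|error n k| =
    k%:R * `|error n k| / (2 * n.+1%:R) by rewrite mulrAC.
have h1 : (1 - k.+1%:R / (2 * n.+1%:R)) * `|error n k.+1| <=
    (1 - k.+1%:R / (2 * n.+1%:R)) * M by rewrite ler_wpM2l.
have h2 : k%:R * `|error n k| / (2 * n.+1%:R) <= M / (2 * n.+1%:R).
  by rewrite ler_pM2r ?invr_gt0// (le_trans (IH n)).
apply: le_trans (lerD h1 h2) _.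
have M0 : 0 <= M by exact: le_trans CM.
rewrite mulrBl mul1r -addrA gerDl addrC subr_le0 mulrAC ler_pM2r ?invr_gt0//.
by rewrite ler_peMl// ler1n.
Qed.

Lemma cvg_degree_law k : e n k.+1 / n.+2%:R @[n --> \oo] --> degree_law k.+1.
Proof.
have [C eC] := error_bounded k.+1.
apply: (@cvg_harmonic_le _ _ _ (C + degree_law k.+1)) => n.
have p0 : 0 <= degree_law k.+1 by rewrite divr_ge0// !mulr_ge0.
have n0 : (n%:R : R) >= 0 by [].
(* There are n + 2 nodes, but the exact solution grows like n + 1: the shift costs one more
   [degree_law k.+1]. *)
have -> : e n k.+1 / n.+2%:R - degree_law k.+1 =
    (error n k.+1 - degree_law k.+1) / n.+2%:R.
  by rewrite /error -!natr1; field; rewrite lt0r_neq0//; lra.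
rewrite normrM normfV (ger0_norm (ler0n _ n.+2)) ler_pM ?invr_ge0//; last first.
  by rewrite lef_pV2 ?posrE// ler_nat.
rewrite (le_trans (ler_normB _ _))// (ger0_norm p0) lerD2r.
by rewrite (le_trans _ (eC n))// ler_peMl// ler1n.
Qed.

End DegreeRecurrence.

(** The sum telescopes, since p_k is a difference of consecutive values of 2 / (k (k+1)); and k^3
    p_k = 4 k^2 / ((k+1)(k+2)) tends to 4. *)
Lemma power_law_degree_law (R : realType) : power_law (@degree_law R).
Proof.
split.
  have sumE n : \sum_(1 <= k < n.+1) degree_law k =
      1 - 2 / (n.+1%:R * n.+2%:R) :> R.
    elim: n => [|n IH]; first by rewrite big_nil; field.
    rewrite big_nat_recr//= IH /degree_law.
    have n0 : (n%:R : R) >= 0 by [].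
    by rewrite -!natr1; field; rewrite !lt0r_neq0//; lra.
  rewrite -(cvg_shiftS (fun n => \sum_(1 <= k < n) degree_law k)) /=.
  apply: (@cvg_harmonic_le _ _ _ 1) => n; rewrite sumE.
  have n0 : (n%:R : R) >= 0 by [].
  have -> : 1 - 2 / (n.+1%:R * n.+2%:R) - 1 = - (2 / (n.+1%:R * n.+2%:R)) :> R.
    by ring.
  rewrite normrN ger0_norm ?divr_ge0 ?mulr_ge0//.
  rewrite ler_pdivrMr ?mulr_gt0// mul1r mulKf ?pnatr_eq0//.
  by rewrite ler_nat.
exists 4, 3; split => //; first by rewrite ltr1n.
(* The error at k is 4 (3k + 2) / ((k+1)(k+2)), at most 12 / (k+1). *)
apply: (@cvg_harmonic_le _ _ _ 12) => -[|k].
  rewrite /degree_law mul0r mul0r invr0 !mulr0 sub0r normrN ger0_norm//.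
  by rewrite invr1 mulr1 ler_nat.
have k0 : (k%:R : R) >= 0 by [].
rewrite (powR_mulrn 3)// /degree_law.
have -> : k.+1%:R ^+ 3 * (4 / (k.+1%:R * k.+2%:R * k.+3%:R)) - 4 =
    - (4 * (3 * k.+1%:R + 2) / (k.+2%:R * k.+3%:R)) :> R.
  by rewrite -!natr1; field; rewrite !lt0r_neq0//; lra.
have d0 : (0 : R) <= 3 * k.+1%:R + 2 by rewrite addr_ge0// mulr_ge0.
rewrite normrN ger0_norm ?divr_ge0 ?mulr_ge0//.
rewrite ler_pdivrMr ?mulr_gt0// mulrA divfK ?pnatr_eq0//.
by rewrite -!natr1; lra.
Qed.

(** * Real-valued probabilities *)

Section RealProbability.
Context d (Omega : measurableType d) (R : realType) (P : probability Omega R).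

Definition pr (A : set Omega) : R := fine (P A).

Lemma prE A : measurable A -> P A = (pr A)%:E.
Proof. by move=> mA; rewrite /pr fineK// fin_num_measure. Qed.

Lemma pr_ge0 A : 0 <= pr A.
Proof. by rewrite fine_ge0. Qed.

Lemma prT : pr setT = 1.
Proof. by rewrite /pr probability_setT. Qed.

Lemma pr0 : pr set0 = 0.
Proof. by rewrite /pr measure0. Qed.

Lemma le_pr A B : measurable A -> measurable B -> A `<=` B -> pr A <= pr B.
Proof. by move=> mA mB AB; rewrite -lee_fin -!prE// le_measure ?inE. Qed.

Lemma prU A B : measurable A -> measurable B -> A `&` B = set0 ->
  pr (A `|` B) = pr A + pr B.
Proof.
move=> mA mB AB; apply: EFin_inj; rewrite EFinD -!prE//; last exact: measurableU.
by rewrite measureU.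
Qed.

Lemma le_prU A B : measurable A -> measurable B ->
  pr (A `|` B) <= pr A + pr B.
Proof.
move=> mA mB; rewrite -lee_fin EFinD -!prE//; last exact: measurableU.
exact: measureU2.
Qed.

Lemma prIC A B : measurable A -> measurable B ->
  pr A = pr (A `&` B) + pr (A `&` ~` B).
Proof.
move=> mA mB; rewrite -prU; first by rewrite -setIUr setUv setIT.
- exact: measurableI.
- by apply: measurableI => //; exact: measurableC.
- by rewrite setIACA setICr setI0.
Qed.

Lemma pr_le1 A : measurable A -> pr A <= 1.
Proof. by move=> mA; rewrite -prT le_pr. Qed.

Lemma pr_full A B : measurable A -> measurable B -> pr B = 1 ->
  pr (A `&` B) = pr A.
Proof.
move=> mA mB B1; rewrite [RHS](prIC mA mB).
suff -> : pr (A `&` ~` B) = 0 by rewrite addr0.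
apply/eqP; rewrite eq_le pr_ge0 andbT.
have mC := measurableC mB.
have := prIC measurableT mB; rewrite !setTI prT B1 => /eqP.
rewrite -subr_eq0 opprD addrA subrr sub0r oppr_eq0 => /eqP <-.
by rewrite le_pr//; exact: measurableI.
Qed.

Lemma pr_sum n (A : set Omega) (F : 'I_n -> set Omega) :
  measurable A -> (forall i, measurable (F i)) -> trivIset setT F ->
  pr (A `&` \big[setU/set0]_(i < n) F i) = \sum_(i < n) pr (A `&` F i).
Proof.
move=> mA mF tF; have mAF i : measurable (A `&` F i) by exact: measurableI.
rewrite big_distrr/=; apply: EFin_inj.
rewrite -prE; last exact: bigsetU_measurable.
rewrite measure_bigsetU_ord//; last exact: trivIset_setIl.
by rewrite -sumEFin; apply: eq_bigr => i _; exact: prE.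
Qed.

Lemma pr_bigcap_full (F : nat -> set Omega) :
  (forall n, measurable (F n)) -> (forall n, pr (F n) = 1) ->
  pr (\bigcap_n F n) = 1.
Proof.
move=> mF F1; have mC n : measurable (~` F n) by exact: measurableC.
have mI : measurable (\bigcap_n F n) by exact: bigcapT_measurable.
have FC0 n : P (~` F n) = 0%E.
  rewrite prE//; congr EFin; have := prIC measurableT (mF n).
  by rewrite !setTI prT F1; lra.
suff C0 : pr (~` \bigcap_n F n) = 0.
  by have := prIC measurableT mI; rewrite !setTI prT C0 addr0.
apply: EFin_inj; rewrite -prE; last exact: measurableC.
rewrite setC_bigcap.
apply/eqP; rewrite eq_le measure_ge0 andbT.
apply: le_trans (measure_sigma_subadditive _ _ _ (@subset_refl _ _)) _ => //.
  exact: bigcup_measurable.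
by rewrite eseries0// => n _ _; exact: FC0.
Qed.

Lemma cvg_pr_le (X : {RV P >-> R}) :
  pr [set w | X w <= t] @[t --> +oo] --> (1 : R).
Proof.
have := cvg_cdfy1 X; rewrite -[1%E]/((1 : R)%:E) => /fine_cvg.
apply: cvg_trans; apply: near_eq_cvg; near=> t.
by congr (fine (P _)).
Unshelve. all: by end_near. Qed.

(* [degree_fraction] is evaluated along a random index that depends on a       *)
(* choice operator, so the integrand below need not be measurable.             *)
Lemma integral_le_nonmeasurable (f g : Omega -> \bar R) :
  (forall w, 0 <= f w)%E -> (forall w, f w <= g w)%E ->
  (\int[P]_w f w <= \int[P]_w g w)%E.
Proof.
move=> f0 fg; have g0 w : (0 <= g w)%E by exact: le_trans (fg w).
(* The integral of a nonnegative function is a supremum over the simple functions below it; those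
   below [f] are below [g]. *)
rewrite !ge0_integralTE//; apply: ereal_sup_le => _ [h /= hf <-].
by exists h => // w; exact: le_trans (fg w).
Qed.

Lemma integral_sum_indic (I : Type) (s : seq I) (c : I -> R)
    (C : I -> set Omega) :
  (forall i, 0 <= c i) -> (forall i, measurable (C i)) ->
  (\int[P]_w (\sum_(i <- s) c i * \1_(C i) w)%:E)%E =
  (\sum_(i <- s) c i * pr (C i))%:E.
Proof.
move=> c0 mC; under eq_integral do rewrite -sumEFin.
rewrite ge0_integral_sum//; last 2 first.
- move=> i; apply/measurable_EFinP.
  exact: measurable_funM.
- by move=> i w _; rewrite lee_fin mulr_ge0.
rewrite -sumEFin; apply: eq_bigr => i _; under eq_integral do rewrite EFinM.
rewrite ge0_integralZl_EFin//; last first.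
  exact/measurable_EFinP.
by rewrite integral_indic// setIT EFinM -prE.
Qed.

End RealProbability.

(** * Joint law of the waiting times and the graphs *)

Section Trajectory.
Context {R : realType} (lambda : R) (lambda_gt0 : 0 < lambda).
Context d (Omega : measurableType d) (P : probability Omega R).
Context (Y : nat -> Omega -> graph) (tau : nat -> {RV P >-> R}).
Hypothesis hY : MC_process Y tau lambda 1 1 +oo%E +oo%E.

Local Notation pr := (pr P).
Local Notation rate := (holding_rate lambda).
Local Notation growth := (growth_step lambda).
Local Notation attach_prob g i :=
  (arrival_rate lambda 1 1 +oo%E +oo%E g i / total_rate lambda 1 1 +oo%E +oo%E g).

Definition holding_law (j : nat) (B : set R) : R :=
  fine (exponential_prob (rate j) B).

Definition waits (a b : nat) (B : nat -> set R) : set Omega :=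
  [set w | forall j, (a <= j < b)%N -> B j (tau j w)].

Let exponential_fin n B : measurable B ->
  exponential_prob (rate n) B = (holding_law n B)%:E.
Proof.
move=> mB; rewrite /holding_law fineK//.
have r0 := holding_rate_gt0 lambda_gt0 n.
have pdf0 x : (0 <= (exponential_pdf (rate n) x)%:E)%E.
  by rewrite lee_fin exponential_pdf_ge0// ltW.
rewrite ge0_fin_numE; last by rewrite /exponential_prob integral_ge0.
apply: (@le_lt_trans _ _ 1%E); last exact: ltry.
rewrite -(integral_exponential_pdf r0) ge0_subset_integral//.
by apply/measurable_EFinP; exact: measurable_exponential_pdf.
Qed.

Lemma holding_lawT n : holding_law n setT = 1.
Proof.
rewrite /holding_law /exponential_prob integral_exponential_pdf//.
exact: holding_rate_gt0.
Qed.

(** Graphs are countable: the event is a countable union over codes of graphs. *)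
Lemma measurable_graph n (U : set graph) : measurable [set w | U (Y n w)].
Proof.
pose code g := pickle (num_nodes g, edges g).
have code_inj : injective code.
  by move=> [a b] [a' b'] /(pcan_inj pickleK)[-> ->].
pose F c := [set w | U (Y n w) /\ code (Y n w) = c].
have -> : [set w | U (Y n w)] = \bigcup_c F c.
  by apply/seteqP; split => [w Uw|w [c _ []//]]; exists (code (Y n w)).
apply: bigcupT_measurable => c.
have [[g [Ug gc]]|no] := pselect (exists g, U g /\ code g = c).
  rewrite (_ : F c = [set w | Y n w = g]); first exact: (MC_measurable hY).
  apply/seteqP; split => w; rewrite /F/=; last by move=> ->.
  by rewrite -gc => -[_ /code_inj].
rewrite (_ : F c = set0)//; apply/seteqP; split => w // [Uw cw].
by apply: no; exists (Y n w).
Qed.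

Lemma measurable_tau j B : measurable B -> measurable [set w | B (tau j w)].
Proof.
by move=> mB; rewrite -[X in measurable X]setTI; exact: measurable_funPT.
Qed.

Lemma measurable_waits a b B : (forall j, measurable (B j)) ->
  measurable (waits a b B).
Proof.
move=> mB; rewrite (_ : waits a b B =
  \bigcap_(j in [set j | (a <= j < b)%N]) [set w | B j (tau j w)]) //.
by apply: bigcap_measurableType => j _; exact: measurable_tau.
Qed.

Lemma historyS n g B : history Y tau n.+1 g B =
  history Y tau n g B `&` [set w | Y n.+1 w = g n.+1 /\ B n (tau n w)].
Proof.
apply/seteqP; split=> w /=.
  move=> [hg hB]; split; last by split; [exact: hg|exact: hB].
  by split=> j jn; [exact/hg/ltnW|exact/hB/ltnW].
move=> [[hg hB] [gn Bn]]; split=> j; rewrite ?ltnS leq_eqVlt.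
  by case/predU1P => [->//|]; rewrite ltnS; exact: hg.
by case/predU1P => [->//|]; exact: hB.
Qed.

Lemma measurable_history n g B : (forall j, measurable (B j)) ->
  measurable (history Y tau n g B).
Proof.
move=> mB; elim: n => [|n IH].
  rewrite (_ : history _ _ _ _ _ = [set w | Y 0%N w = g 0%N]).
    exact: (MC_measurable hY).
  apply/seteqP; split => w /=; first by case => + _; exact.
  by move=> w0; split => // j; rewrite leqn0 => /eqP ->.
rewrite historyS; apply: measurableI => //.
apply: (measurableI [set w | Y n.+1 w = g n.+1] [set w | B n (tau n w)]).
  exact: (MC_measurable hY).
exact: measurable_tau.
Qed.

Lemma eq_history n g g' B B' : (forall j, (j <= n)%N -> g j = g' j) ->
  (forall j, (j < n)%N -> B j = B' j) ->
  history Y tau n g B = history Y tau n g' B'.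
Proof.
move=> gg' BB'; apply/seteqP; split => w /= [h1 h2]; split => j jn.
- by rewrite -gg'// h1.
- by rewrite -BB'//; exact: h2.
- by rewrite gg'// h1.
- by rewrite BB'//; exact: h2.
Qed.

(** * Law of the trajectories *)

Lemma pr_transition n g B i : (forall j, measurable (B j)) ->
  grown_tree n (g n) -> (i < num_nodes (g n))%N ->
  pr (history Y tau n g B `&`
      [set w | Y n.+1 w = attach (g n) i /\ B n (tau n w)]) =
  pr (history Y tau n g B) * attach_prob (g n) i * holding_law n (B n).
Proof.
move=> mB gn ni; apply: EFin_inj; rewrite -prE; last first.
  apply: measurableI; first exact: measurable_history.
  apply: (measurableI [set w | Y n.+1 w = attach (g n) i]
    [set w | B n (tau n w)]).
    exact: (MC_measurable hY).
  exact: measurable_tau.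
rewrite (MC_transition hY)// (total_rateE lambda gn).
rewrite exponential_fin; last exact: mB.
by rewrite (prE P (measurable_history _ _ mB)).
Qed.

Let attached n (h : graph) (i : nat) : set Omega :=
  [set w | Y n.+1 w = attach h i].

Let measurable_attached n h i : measurable (attached n h i).
Proof. exact: (MC_measurable hY). Qed.

Let trivIset_attached n h (N : nat) :
  trivIset setT (fun i : 'I_N => attached n h i).
Proof.
move=> i j _ _ [w [/= ]]; rewrite /attached/= => -> [ij].
exact: val_inj.
Qed.

(** Since the attachment probabilities sum to 1, the pieces of the history already carry all its
    mass; the event that no node of [g n] is joined is null. *)
Lemma pr_attached n g B (A : set Omega) : (forall j, measurable (B j)) ->
  grown_tree n (g n) -> measurable A -> A `<=` history Y tau n g B ->
  pr A = \sum_(i < num_nodes (g n)) pr (A `&` attached n (g n) i).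
Proof.
move=> mB gn mA AH; have mH := measurable_history n g mB.
set F := fun i : 'I_(num_nodes (g n)) => attached n (g n) i.
have mF i : measurable (F i) by exact: measurable_attached.
have tF : trivIset setT F by exact: trivIset_attached.
rewrite -(pr_sum P mA mF tF); set U := \big[setU/set0]_(i < _) F i.
have mU : measurable U by exact: bigsetU_measurable.
have mUC := measurableC mU.
rewrite (prIC P mA mU).
suff -> : pr (A `&` ~` U) = 0 by rewrite addr0.
apply/eqP; rewrite eq_le pr_ge0 andbT.
apply: (@le_trans _ _ (pr (history Y tau n g B `&` ~` U))).
  by apply: le_pr; [exact: measurableI|exact: measurableI|exact: setSI].
rewrite -(lerD2l (pr (history Y tau n g B `&` U))) -prIC// addr0.
rewrite pr_sum//.
(* The history reads [B] only below [n]; resetting [B n] to the whole line removes the constraint on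
   [tau n]. *)
pose B' j := if (j < n)%N then B j else setT.
have mB' j : measurable (B' j) by rewrite /B'; case: ifP.
have HB' : history Y tau n g B = history Y tau n g B'.
  by apply: eq_history => // j jn; rewrite /B' jn.
rewrite HB' -[leLHS]mulr1 -(sum_attach_prob lambda_gt0 gn) mulr_sumr.
apply: ler_sum => i _; have := pr_transition mB' gn (ltn_ord i).
have B'n : B' n = setT by rewrite /B' ltnn.
rewrite B'n holding_lawT mulr1 => <-.
apply: le_pr.
- apply: measurableI; first exact: measurable_history.
  apply: (measurableI [set w | Y n.+1 w = attach (g n) i]
    [set w | [set: R] (tau n w)]).
    exact: measurable_attached.
  exact: measurable_tau.
- by apply: measurableI => //; exact: measurable_history.
- by move=> w [hw [aw _]].
Qed.

(** Induction on [m], splitting by the node joined at the first arrival. The holding rate is the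
    same in every branch, as it depends only on [n], so its factor leaves the sum and the waiting
    times decouple from the graphs. *)
Lemma pr_growth m n g B (U : set graph) : (forall j, measurable (B j)) ->
  grown_tree n (g n) ->
  pr (history Y tau n g B `&` waits n (n + m).+1 B `&`
      [set w | U (Y (n + m)%N w)]) =
  pr (history Y tau n g B) * (\prod_(n <= j < (n + m).+1) holding_law j (B j)) *
  iter m growth (\1_U) (g n).
Proof.
elim: m n g => [|m IH] n g mB gn.
  have mH := measurable_history n g mB.
  rewrite addn0 big_nat1 /=.
  have mt : measurable [set w | B n (tau n w)] by exact: measurable_tau.
  (* [MC_transition] gives [tau n] only jointly with the next graph, so the node joined is summed
     out. *)
  have HB : pr (history Y tau n g B `&` [set w | B n (tau n w)]) =
      pr (history Y tau n g B) * holding_law n (B n).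
    rewrite (pr_attached mB gn); last first.
    - by move=> w [].
    - exact: measurableI.
    rewrite -[RHS]mulr1 -(sum_attach_prob lambda_gt0 gn) mulr_sumr.
    apply: eq_bigr => i _; rewrite mulrAC -pr_transition//.
    congr (fine (P _)); apply/seteqP; rewrite /attached.
    by split => w /=; tauto.
  have wE : waits n n.+1 B = [set w | B n (tau n w)].
    apply/seteqP; split => w /=; first by apply; rewrite leqnn ltnSn.
    by move=> Bn j /andP[nj]; rewrite ltnS => jn; rewrite (_ : j = n)//;
      apply/eqP; rewrite eqn_leq nj jn.
  rewrite wE indicE; have [Ug|Ug] := pselect (U (g n)).
    rewrite mem_set// mulr1 -HB; congr (fine (P _)).
    apply/seteqP; split => w /=; first by case.
    by move=> [[h1 h2] h3]; split => //; rewrite h1.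
  rewrite memNset// mulr0 -(pr0 P); congr (fine (P _)).
  by apply/seteqP; split => w //= [[[h1 h2] h3]]; rewrite h1.
have mH := measurable_history n g mB.
rewrite (pr_attached mB gn); last first.
- by move=> w [[]].
- apply: measurableI; last exact: measurable_graph.
  by apply: measurableI => //; exact: measurable_waits.
rewrite /= {1}/growth_step mulr_sumr; apply: eq_bigr => i _.
pose g' j := if (j <= n)%N then g j else attach (g n) i.
have g'n : g' n = g n by rewrite /g' leqnn.
have g'n1 : g' n.+1 = attach (g n) i by rewrite /g' ltnn.
have := IH n.+1 g' mB; rewrite g'n1 => /(_ (grown_tree_attach gn (ltn_ord i))).
have HE : history Y tau n g' B = history Y tau n g B.
  by apply: eq_history => // j jn; rewrite /g' jn.
rewrite historyS g'n1 HE pr_transition// addSnnS.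
rewrite (@big_ltn _ _ _ n)//; last by rewrite ltnS leq_addr.
move=> IH'; transitivity (pr (history Y tau n g B) * attach_prob (g n) i *
  holding_law n (B n) * (\prod_(n.+1 <= j < (n + m.+1).+1) holding_law j (B j)) *
  iter m growth \1_U (attach (g n) i)); last by ring.
rewrite -IH'; congr (fine (P _)); apply/seteqP; rewrite /attached; split => w /=.
  move=> [[[hw ww] Uw] aw]; split => //; split.
    by split => //; split => //; apply: ww; rewrite leqnn ltnS leq_addr.
  by move=> j /andP[nj jn]; apply: ww; rewrite jn ltnW.
move=> [[[hw [aw Bn]] ww] Uw]; do 3!split => //.
move=> j /andP[]; rewrite leq_eqVlt => /predU1P[<-//|nj jn].
by apply: ww; rewrite nj jn.
Qed.

(** * Independence of the waiting times and the graphs *)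

Lemma pr_waits_graph m B (U : set graph) : (forall j, measurable (B j)) ->
  pr (waits 0 m.+1 B `&` [set w | U (Y m w)]) =
  (\prod_(0 <= j < m.+1) holding_law j (B j)) * iter m growth (\1_U) single_edge.
Proof.
move=> mB.
have := pr_growth (g := fun=> single_edge) m U mB grown_tree_single_edge.
rewrite (_ : history _ _ _ _ _ = setT) ?setTI ?prT ?mul1r// -subTset.
by move=> w _; split => // j; rewrite leqn0 => /eqP ->; exact: (MC_start hY).
Qed.

Lemma pr_graph m (U : set graph) :
  pr [set w | U (Y m w)] = iter m growth (\1_U) single_edge.
Proof.
have := @pr_waits_graph m (fun=> setT) U (fun=> measurableT).
rewrite (_ : waits _ _ _ = setT) ?setTI; last by rewrite -subTset.
by rewrite big1 ?mul1r// => j _; exact: holding_lawT.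
Qed.

Lemma pr_grown_tree m : pr [set w | grown_tree m (Y m w)] = 1.
Proof.
rewrite pr_graph.
rewrite (eq_growth_step (F' := fun=> 1) _ _ grown_tree_single_edge).
  exact: growth_step_cst grown_tree_single_edge.
by move=> g gm; rewrite indicE mem_set.
Qed.

Lemma pr_waits m B : (forall j, measurable (B j)) ->
  pr (waits 0 m B) = \prod_(0 <= j < m) holding_law j (B j).
Proof.
case: m => [|m] mB.
  by rewrite big_geq// (_ : waits _ _ _ = setT) ?prT// -subTset.
rewrite -(pr_full _ _ (pr_grown_tree m)); last first.
- exact: measurable_graph.
- exact: measurable_waits.
rewrite pr_waits_graph//; have := pr_grown_tree m; rewrite pr_graph => ->.
by rewrite mulr1.
Qed.

Lemma prod_holding_law n B C :
  \prod_(0 <= j < n.+1) holding_law j (if j == n then C else B j) =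
  (\prod_(0 <= j < n) holding_law j (B j)) * holding_law n C.
Proof.
rewrite big_nat_recr//= eqxx; congr (_ * _).
by apply: eq_big_nat => j /andP[_ jn]; rewrite ltn_eqF.
Qed.

Lemma pr_waits_tau n B C : (forall j, measurable (B j)) -> measurable C ->
  pr (waits 0 n B `&` [set w | C (tau n w)]) = pr (waits 0 n B) * holding_law n C.
Proof.
move=> mB mC; rewrite [X in _ = X * _]pr_waits// -prod_holding_law.
rewrite -pr_waits; last first.
  by move=> j; case: ifP.
congr (fine (P _)); apply/seteqP; split => w /=.
  move=> [hB hC] j /andP[_]; rewrite ltnS leq_eqVlt => /predU1P[->|jn].
    by rewrite eqxx.
  by rewrite ltn_eqF//; exact: hB.
move=> h; split; last by have := h n; rewrite eqxx; apply; rewrite ltnSn.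
by move=> j jn; have := h j; rewrite (ltn_eqF jn); apply; exact: ltnW.
Qed.

Lemma pr_tau n C : measurable C -> pr [set w | C (tau n w)] = holding_law n C.
Proof.
move=> mC; have := @pr_waits_tau n (fun=> setT) C (fun=> measurableT) mC.
rewrite (_ : waits _ _ _ = setT) ?setTI ?prT ?mul1r//.
by rewrite -subTset.
Qed.

(** A pi-system generating the sigma-algebra of the first [m] waiting times. *)
Definition waits_sets (m : nat) : set (set Omega) :=
  [set E | exists2 B, (forall j, measurable (B j)) & E = waits 0 m B].

Lemma setI_closed_waits_sets m : setI_closed (waits_sets m).
Proof.
move=> _ _ [B mB ->] [B' mB' ->]; exists (fun j => B j `&` B' j).
  by move=> j; exact: measurableI.
apply/seteqP; split => w /=.
  by move=> [h h'] j jm; split; [exact: h|exact: h'].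
by move=> h; split => j /h[].
Qed.

Lemma sigma_waits_sets_measurable m E : <<s waits_sets m >> E -> measurable E.
Proof.
move: E; apply: smallest_sub; first exact: sigma_algebra_measurable.
by move=> _ [B mB ->]; exact: measurable_waits.
Qed.

(** Dynkin's argument: the events satisfying the product formula form a Dynkin system that contains
    a generating pi-system. *)
Lemma pr_sigma_waits_sets m Q c : measurable Q ->
  (forall B, (forall j, measurable (B j)) ->
    pr (waits 0 m B `&` Q) = pr (waits 0 m B) * c) ->
  forall E, <<s waits_sets m >> E -> pr (E `&` Q) = pr E * c.
Proof.
move=> mQ HQ.
(* Unconstrained waiting times force [c] to be the probability of [Q], as closure under complement
   requires. *)
have cE : c = pr Q.
  have := HQ (fun=> setT) (fun=> measurableT).
  by rewrite (_ : waits _ _ _ = setT) ?setTI ?prT ?mul1r// -subTset.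
rewrite -setI_closed_g_dynkin_g_sigma_algebra; last exact: setI_closed_waits_sets.
suff sub : <<d waits_sets m >> `<=`
    [set E | measurable E /\ pr (E `&` Q) = pr E * c] by move=> E /sub[].
apply: smallest_sub; last first.
  by move=> _ [B mB ->]; split; [exact: measurable_waits|exact: HQ].
split => /=.
- by split => //; rewrite setTI prT mul1r cE.
- move=> E [mE EQ]; split; first exact: measurableC.
  have := prIC P mQ mE; rewrite ![Q `&` _]setIC EQ -cE => cEQ.
  have := prIC P measurableT mE; rewrite !setTI prT => E1.
  have -> : pr (~` E) = 1 - pr E by rewrite E1; ring.
  by rewrite mulrBl mul1r [X in X - _]cEQ; ring.
- move=> F tF HF; have mF i : measurable (F i) by have [] := HF i.
  have mFQ i : measurable (F i `&` Q) by exact: measurableI.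
  split; first exact: bigcupT_measurable.
  rewrite setI_bigcupl; apply: EFin_inj; rewrite mulrC EFinM -!prE.
  + rewrite !measure_bigcup//=; last exact: trivIset_setIr.
    rewrite -nneseriesZl//.
    apply: eq_eseriesr => i _; have [_] := HF i.
    by rewrite !prE// => ->; rewrite mulrC.
  + exact: bigcupT_measurable.
  + exact: bigcupT_measurable.
Qed.

Lemma sigma_arrival_time m n B : (n <= m)%N -> measurable B ->
  <<s waits_sets m >> [set w | B (arrival_time tau n w)].
Proof.
(* Measurability is checked on [Omega] equipped with the generated sigma-algebra, where each [tau j]
   below [m] is measurable. *)
move=> nm mB; pose T := g_sigma_algebraType (waits_sets m).
have mt (j : 'I_n) : measurable_fun [set: T] (tau j : T -> R).
  move=> _ C mC; rewrite setTI; apply: sub_sigma_algebra.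
  exists (fun i => if i == j :> nat then C else setT).
    by move=> i; case: ifP.
  apply/seteqP; split => w /=.
    by move=> Cw i _; case: eqP => [->|].
  by move=> /(_ j); rewrite eqxx; apply; rewrite (leq_trans (ltn_ord j)).
have := measurable_sum (index_enum 'I_n) mt measurableT mB.
by rewrite setTI.
Qed.

Lemma arrival_timeS n w :
  arrival_time tau n.+1 w = arrival_time tau n w + tau n w.
Proof. by rewrite /arrival_time big_ord_recr. Qed.

Lemma measurable_arrival_time n B : measurable B ->
  measurable [set w | B (arrival_time tau n w)].
Proof.
move=> mB; apply: (sigma_waits_sets_measurable (m := n)).
exact: sigma_arrival_time.
Qed.

Lemma measurable_arrival_le n t : measurable [set w | arrival_time tau n w <= t].
Proof.
rewrite (_ : [set w | _] = [set w | [set` `]-oo, t]%R] (arrival_time tau n w)]).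
  exact: measurable_arrival_time.
by apply/seteqP; split => w /=; rewrite in_itv.
Qed.

Lemma pr_arrival_tau n t C : measurable C ->
  pr ([set w | arrival_time tau n w <= t] `&` [set w | C (tau n w)]) =
  pr [set w | arrival_time tau n w <= t] * holding_law n C.
Proof.
move=> mC; apply: (pr_sigma_waits_sets (m := n)).
- exact: measurable_tau.
- by move=> B mB; exact: pr_waits_tau.
- rewrite (_ : [set w | _] = [set w | [set` `]-oo, t]%R] (arrival_time tau n w)]).
    exact: sigma_arrival_time.
  by apply/seteqP; split => w /=; rewrite in_itv.
Qed.

Lemma pr_graph_indep n (U : set graph) E : <<s waits_sets n.+1 >> E ->
  pr (E `&` [set w | U (Y n w)]) = pr E * pr [set w | U (Y n w)].
Proof.
apply: pr_sigma_waits_sets; first exact: measurable_graph.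
by move=> B mB; rewrite pr_waits_graph// pr_waits// pr_graph.
Qed.

(** * Lower tail of the arrival times *)

Lemma holding_law_lt0 n : holding_law n [set` `]-oo, 0[%R] = 0.
Proof.
rewrite /holding_law /exponential_prob integral0_eq// => x /=.
by rewrite in_itv/= => x0; rewrite lt0_exponential_pdf.
Qed.

Lemma holding_law_le n s : 0 < s ->
  holding_law n [set` `[0, s]%R] = 1 - expR (- (rate n) * s).
Proof. by move=> s0; rewrite /holding_law exponential_prob_itv0c. Qed.

Lemma holding_law_gt n s : 0 < s ->
  holding_law n [set` `]s, +oo[%R] = expR (- (rate n) * s).
Proof.
move=> s0; have m1 := measurable_tau n (measurable_itv `]-oo, 0[%R).
have m2 := measurable_tau n (measurable_itv `[0, s]%R).
have m3 := measurable_tau n (measurable_itv `]s, +oo[%R).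
have m12 := measurableU _ _ m1 m2.
have := prT P.
rewrite (_ : setT = ([set w | [set` `]-oo, 0[%R] (tau n w)] `|`
  [set w | [set` `[0, s]%R] (tau n w)]) `|`
  [set w | [set` `]s, +oo[%R] (tau n w)]).
- rewrite prU//; last first.
    apply/seteqP; split => w //= []; rewrite !in_itv/= andbT => h1 h2.
    by case: h1 => [|/andP[_]]; lra.
  rewrite prU//; last first.
    by apply/seteqP; split => w //= []; rewrite !in_itv/= => h1 /andP[h2]; lra.
  by rewrite !pr_tau// holding_law_lt0 holding_law_le//; lra.
- apply/esym; rewrite -subTset => w _ /=; rewrite !in_itv/= andbT.
  have [|h1] := ltP (tau n w) 0; first by left; left.
  by have [|h2] := leP (tau n w) s; [left; right|right].
Qed.

(* Chernoff bound, each waiting time being minorized by half its mean, taken   *)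
(* with probability exp(-1/2), and by 0 otherwise.                             *)
Lemma pr_arrival_le n t :
  pr [set w | arrival_time tau n w <= t] <= expR (8 * lambda * t) * (2 / n.+2%:R).
Proof.
elim: n t => [|n IH] t.
  (* The time of arrival 0 is 0: the bound is at least 1 when [t] is nonnegative, and the event is
     empty otherwise. *)
  rewrite divff// mulr1; have [t0|t0] := leP 0 t.
    apply: (@le_trans _ _ 1); first exact/pr_le1/measurable_arrival_le.
    by rewrite -expR0 ler_expR !mulr_ge0// ltW.
  rewrite (_ : [set w | _] = set0) ?pr0 ?expR_ge0//.
  apply/seteqP; split => w //=; rewrite /arrival_time big_ord0.
  by rewrite leNgt t0.
have r0 := holding_rate_gt0 lambda_gt0 n.
pose s := (2 * rate n)^-1.
have s0 : 0 < s by rewrite invr_gt0 mulr_gt0.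
pose q := expR (- (rate n) * s).
have q_half : 2^-1 <= q.
  have -> : 2^-1 = 1 + - (rate n) * s :> R.
    by rewrite /s; field; rewrite lt0r_neq0.
  exact: expR_ge1Dx.
have q1 : q <= 1.
  by rewrite -expR0 ler_expR mulNr oppr_le0 mulr_ge0// ltW.
pose A x := [set w | arrival_time tau n w <= x].
have mA x : measurable (A x) by exact: measurable_arrival_le.
pose I1 := [set w | [set` `[0, s]%R] (tau n w)].
pose I2 := [set w | [set` `]s, +oo[%R] (tau n w)].
pose I0 := [set w | [set` `]-oo, 0[%R] (tau n w)].
have m0 : measurable I0 by exact: measurable_tau.
have m1 : measurable I1 by exact: measurable_tau.
have m2 : measurable I2 by exact: measurable_tau.
have mA1 : measurable (A t `&` I1) by exact: measurableI.
have mA2 : measurable (A (t - s) `&` I2) by exact: measurableI.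
(* Negative waits are null; a wait longer than [s] forces the previous arrival before [t - s]. That
   arrival time is independent of [tau n]. *)
have step : pr [set w | arrival_time tau n.+1 w <= t] <=
    pr (A t) * (1 - q) + pr (A (t - s)) * q.
  have le_q := holding_law_le n s0; have gt_q := holding_law_gt n s0.
  rewrite -/q in le_q gt_q; rewrite -le_q -gt_q -!pr_arrival_tau//.
  have I0_null : pr I0 = 0 by rewrite pr_tau// holding_law_lt0.
  have mA12 := measurableU _ _ mA1 mA2.
  apply: (@le_trans _ _ (pr (A t `&` I1 `|` A (t - s) `&` I2 `|` I0))).
    apply: le_pr; [exact: measurable_arrival_le|exact: measurableU|].
    move=> w /=; rewrite /A/I0/I1/I2/= arrival_timeS !in_itv/= andbT.
    have [|h1] := ltP (tau n w) 0; first by right.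
    have [h2|h2] := leP (tau n w) s => h; left; [left|right]; split => //; lra.
  by rewrite (le_trans (le_prU P mA12 m0))// I0_null addr0 le_prU.
apply: (le_trans step).
pose a := expR (- (8 * lambda * s)).
have aE : expR (8 * lambda * (t - s)) = expR (8 * lambda * t) * a.
  by rewrite /a -expRD; congr expR; ring.
have n0 : (n%:R : R) >= 0 by [].
(* The constant 8 makes the exponent 2 / (n+1), and exp x >= 1 + x then bounds [a]. *)
have a_le : a <= n.+1%:R / n.+3%:R.
  have sE : 8 * lambda * s = 2 / n.+1%:R.
    rewrite /s /holding_rate -natr1; field; rewrite !lt0r_neq0//; lra.
  rewrite /a expRN sE -[leRHS]invrK lef_pV2 ?posrE ?expR_gt0//.
  apply: le_trans (expR_ge1Dx _); rewrite le_eqVlt; apply/orP; left; apply/eqP.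
  by rewrite -!natr1; field; rewrite !lt0r_neq0//; lra.
have IHt := IH t; have IHs := IH (t - s).
have qp : 0 <= 1 - q by rewrite subr_ge0.
have q0 : 0 <= q by rewrite expR_ge0.
set E := expR (8 * lambda * t) in aE IHt *.
have E0 : 0 <= E by rewrite expR_ge0.
apply: (@le_trans _ _ (E * (2 / n.+2%:R) * (1 - q) + E * a * (2 / n.+2%:R) * q)).
  by rewrite -aE lerD// ler_wpM2r.
have -> : E * (2 / n.+2%:R) * (1 - q) + E * a * (2 / n.+2%:R) * q =
  E * (2 / n.+2%:R * (1 - q * (1 - a))) by ring.
rewrite ler_wpM2l//.
have -> : 2 / n.+3%:R = 2 / n.+2%:R * (n.+2%:R / n.+3%:R) :> R.
  by rewrite -!natr1; field; rewrite !lt0r_neq0//; lra.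
rewrite ler_wpM2l//.
(* So the bound shrinks by at least 1 - 1 / (n+3) = (n+2) / (n+3), which turns 2 / (n+2) into 2 /
   (n+3). *)
have qa : 2^-1 * (2 / n.+3%:R) <= q * (1 - a).
  rewrite ler_pM ?invr_ge0 ?divr_ge0//.
  have -> : 2 / n.+3%:R = 1 - n.+1%:R / n.+3%:R :> R.
    by rewrite -!natr1; field; rewrite !lt0r_neq0//; lra.
  by rewrite lerD2l lerN2.
have -> : n.+2%:R / n.+3%:R = 1 - 2^-1 * (2 / n.+3%:R) :> R.
  by rewrite -!natr1; field; rewrite !lt0r_neq0//; lra.
by rewrite lerD2l lerN2.
Qed.

(** * Almost sure behaviour of the trajectories *)

Definition regular : set Omega :=
  \bigcap_n ([set w | grown_tree n (Y n w)] `&`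
    [set w | [set` `[0, +oo[%R] (tau n w)]).

Lemma measurable_regular : measurable regular.
Proof.
apply: bigcapT_measurable => n.
by apply: measurableI; [exact: measurable_graph|exact: measurable_tau].
Qed.

Lemma pr_regular : pr regular = 1.
Proof.
apply: pr_bigcap_full => n.
  by apply: measurableI; [exact: measurable_graph|exact: measurable_tau].
rewrite setIC pr_full; last exact: pr_grown_tree.
- have mneg : measurable [set w | [set` `]-oo, 0[%R] (tau n w)].
    exact: measurable_tau.
  have mpos : measurable [set w | [set` `[0, +oo[%R] (tau n w)].
    exact: measurable_tau.
  rewrite -(prT P) (prIC P measurableT mpos) !setTI -[LHS]addr0; congr (_ + _).
  rewrite -[LHS](holding_law_lt0 n) -pr_tau//; congr (fine (P _)).
  by apply/seteqP; split => w /=; rewrite !in_itv/= andbT ltNge => /negP.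
- exact: measurable_tau.
- exact: measurable_graph.
Qed.

Lemma le_arrival_time m n w : regular w -> (m <= n)%N ->
  arrival_time tau m w <= arrival_time tau n w.
Proof.
move=> rw; elim: n => [|n IH]; first by rewrite leqn0 => /eqP ->.
rewrite leq_eqVlt => /predU1P[->//|mn].
rewrite (le_trans (IH mn))// arrival_timeS lerDl.
by have [_] := rw n Logic.I; rewrite /= in_itv/= andbT.
Qed.

(** * The expected fraction at a fixed time *)

Section ObservationTime.
Variable t : R.

Let arrived n := [set w | arrival_time tau n w <= t].

Let measurable_arrived n : measurable (arrived n).
Proof. exact: measurable_arrival_le. Qed.

Let arrived_regular m n w : regular w -> (m <= n)%N -> arrived n w -> arrived m w.
Proof. by move=> rw mn; apply: le_trans; exact: le_arrival_time. Qed.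

(** On [regular], this says that the number of arrivals up to [t] lies in [m, n). *)
Let between m n := arrived m `&` ~` arrived n.

Let measurable_between m n : measurable (between m n).
Proof. by apply: measurableI => //; exact: measurableC. Qed.

Lemma pr_between m n : (m <= n)%N ->
  pr (between m n) = pr (arrived m) - pr (arrived n).
Proof.
move=> mn; have mR := measurable_regular.
apply/eqP; rewrite eq_sym subr_eq addrC; apply/eqP.
rewrite (prIC P (measurable_arrived m) (measurable_arrived n)); congr (_ + _).
have mI : measurable (arrived m `&` arrived n) by exact: measurableI.
rewrite -(pr_full mI mR pr_regular).
rewrite -(pr_full (measurable_arrived n) mR pr_regular).
congr (fine (P _)); apply/seteqP; split => w [] /=; first by move=> [].
by move=> hn rw; split => //; split => //; exact: arrived_regular hn.
Qed.

(** Having exactly [n] arrivals depends on [tau 0] to [tau n] only, which are jointly independent of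
    [Y n]. *)
Lemma sigma_between n : <<s waits_sets n.+1 >> (between n n.+1).
Proof.
have arrived_sigma m : (m <= n.+1)%N -> <<s waits_sets n.+1 >> (arrived m).
  move=> mn; rewrite (_ : arrived m =
      [set w | [set` `]-oo, t]%R] (arrival_time tau m w)]).
    exact: sigma_arrival_time.
  by apply/seteqP; split => w /=; rewrite in_itv.
rewrite /between -setDE.
apply: (@measurableD _ (g_sigma_algebraType (waits_sets n.+1))).
- exact: arrived_sigma.
- exact: arrived_sigma.
Qed.

(** Arrival times increase on [regular], so the index selected by [xget] is unique. *)
Lemma graph_at_between n w : regular w -> between n n.+1 w ->
  graph_at Y tau t w = Y n w.
Proof.
move=> rw [an /negP an1]; rewrite /graph_at.
have lt_arr m : (t < arrival_time tau m w) = ~~ (arrival_time tau m w <= t).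
  by rewrite ltNge.
congr (Y _ w); apply: xget_unique; first by rewrite /= lt_arr an1 andbT.
move=> m; rewrite /= lt_arr => /andP[am am1].
have [lt|lt|//] := ltngtP m n.
  by move: am1; rewrite (arrived_regular rw lt).
by move: an1; rewrite (arrived_regular rw lt).
Qed.

Variable k : nat.

Let fraction w : R := degree_fraction R (graph_at Y tau t w) k.+1.

Let fraction_ge0 w : 0 <= fraction w.
Proof. by rewrite divr_ge0. Qed.

Let fraction_le1 w : fraction w <= 1.
Proof.
rewrite /fraction /degree_fraction; set g := graph_at _ _ _ _.
have [->|N0] := eqVneq (num_nodes g) 0%N; first by rewrite invr0 mulr0.
rewrite ler_pdivrMr ?ltr0n ?lt0n// mul1r ler_nat.
rewrite -[leqRHS]card_ord -sum1_card; apply: leq_sum => i _.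
exact: leq_b1.
Qed.

Definition mean_fraction (n : nat) : R :=
  iter n growth (degree_count k.+1) single_edge / n.+2%:R.

Let node_event n i :=
  (between n n.+1 `&` [set w | [set g | degree g i = k.+1] (Y n w)]) `&` regular.

Let measurable_node_event n i : measurable (node_event n i).
Proof.
apply: measurableI; last exact: measurable_regular.
by apply: measurableI => //; exact: measurable_graph.
Qed.

Lemma pr_node_events n :
  \sum_(0 <= i < n.+2) n.+2%:R^-1 * pr (node_event n i) =
  (pr (arrived n) - pr (arrived n.+1)) * mean_fraction n.
Proof.
rewrite /mean_fraction -pr_between// -mulr_sumr mulrA [RHS]mulrC; congr (_ * _).
(* Writing the count as a sum of indicators, one per node, turns the mean into probabilities of
   graph events. *)
rewrite (eq_growth_step (F' := fun g => \sum_(i < n.+2)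
  \1_[set h | degree h i = k.+1] g) _ _ grown_tree_single_edge); last first.
  move=> g gn; rewrite (degree_countE _ gn); apply: eq_bigr => i _.
  rewrite indicE; congr (nat_of_bool _)%:R.
  by apply/eqP/idP; rewrite inE.
rewrite growth_step_sum mulr_sumr big_mkord; apply: eq_bigr => i _.
rewrite pr_full; last exact: pr_regular.
- by rewrite pr_graph_indep ?pr_graph//; exact: sigma_between.
- by apply: measurableI => //; exact: measurable_graph.
- exact: measurable_regular.
Qed.

(** On trajectories with between [m] and [n - 1] arrivals, the fraction is thus a finite combination
    of measurable indicators. *)
Lemma sum_node_events m n w : (m <= n)%N ->
  \sum_(m <= j < n) \sum_(0 <= i < j.+2) j.+2%:R^-1 * \1_(node_event j i) w =
  \1_(between m n `&` regular) w * fraction w.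
Proof.
move=> mn; have [rw|nrw] := pselect (regular w); last first.
  rewrite indicE memNset ?mul0r; last by case.
  rewrite big1// => j _; rewrite big1// => i _.
  by rewrite indicE memNset ?mulr0//; case.
have betweenE a b : (a <= b)%N -> \1_(between a b `&` regular) w =
    \1_(arrived a) w - \1_(arrived b) w :> R.
  move=> ab; rewrite !indicE; have [wb|nwb] := pselect (arrived b w).
    rewrite memNset; last by case=> -[].
    by rewrite !mem_set ?subrr//; exact: arrived_regular wb.
  rewrite (memNset nwb) subr0; congr (nat_of_bool _)%:R.
  by apply/idP/idP; rewrite !inE; [case=> -[]|].
have <- : \sum_(m <= j < n) (\1_(arrived j) w - \1_(arrived j.+1) w) =
    \1_(between m n `&` regular) w :> R.
  rewrite betweenE// (telescope_sumr_eq (fun j => - \1_(arrived j) w))//.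
    by rewrite opprK addrC.
  by move=> j _; rewrite opprK addrC.
rewrite mulr_suml; apply: eq_bigr => j _; rewrite -betweenE// indicE.
have [wj|nwj] := pselect (between j j.+1 w); last first.
  rewrite memNset ?mul0r; last by case.
  by rewrite big1// => i _; rewrite indicE memNset ?mulr0//; case=> -[].
rewrite mem_set// mul1r /fraction (graph_at_between rw wj) /degree_fraction.
have [N _ _ _] : grown_tree j (Y j w) by have [] := rw j Logic.I.
rewrite N natr_sum mulr_suml big_mkord; apply: eq_bigr => i _.
rewrite mulrC indicE; congr (_ * _); congr (nat_of_bool _)%:R.
by apply/idP/eqP; rewrite inE; [case=> -[]|].
Qed.

(** The fraction is squeezed between two simple functions: it is known on [D] and lies in [0, 1]
    outside, so monotonicity of the integral suffices. *)
Lemma expected_degree_fraction_bounds m n s : (m <= n)%N ->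
  s = \sum_(m <= j < n)
    (pr (arrived j) - pr (arrived j.+1)) * mean_fraction j ->
  (s%:E <= expected_degree_fraction Y tau k.+1 t <=
    (s + (1 - (pr (arrived m) - pr (arrived n))))%:E)%E.
Proof.
move=> mn sE; rewrite /expected_degree_fraction unlock.
pose D := between m n `&` regular.
have mD : measurable D by apply: measurableI => //; exact: measurable_regular.
have prD : pr D = pr (arrived m) - pr (arrived n).
  by rewrite pr_full ?pr_between//; [exact: measurable_regular|exact: pr_regular].
pose I := [seq (j, i) | j <- index_iota m n, i <- index_iota 0 j.+2].
pose c (x : nat * nat) : R := x.1.+2%:R^-1.
pose C (x : nat * nat) := node_event x.1 x.2.
have sumI w : \sum_(x <- I) c x * \1_(C x) w = \1_D w * fraction w.
  by rewrite big_allpairs_dep sum_node_events.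
have sumP : \sum_(x <- I) c x * pr (C x) = s.
  by rewrite sE big_allpairs_dep; apply: eq_bigr => j _; exact: pr_node_events.
apply/andP; split.
  rewrite -sumP -integral_sum_indic; last 2 first.
  - by move=> x; rewrite /c invr_ge0.
  - by move=> x; exact: measurable_node_event.
  apply: integral_le_nonmeasurable => w; rewrite lee_fin sumI.
    by rewrite mulr_ge0// indicE.
  rewrite indicE; case: (w \in D); first by rewrite mul1r.
  by rewrite mul0r fraction_ge0.
(* The extra index [None] adds the complement of [D] with weight 1. *)
pose c' x := if x is Some y then c y else 1.
pose C' x := if x is Some y then C y else ~` D.
have -> : s + (1 - (pr (arrived m) - pr (arrived n))) =
    \sum_(x <- None :: map Some I) c' x * pr (C' x).
  rewrite big_cons big_map sumP mul1r addrC -prD; congr (_ + _).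
  by have := prIC P measurableT mD; rewrite !setTI prT /=; lra.
rewrite -integral_sum_indic; last 2 first.
- by case=> [x|]; rewrite /= ?/c ?invr_ge0.
- by case=> [x|]; [exact: measurable_node_event|exact: measurableC].
apply: integral_le_nonmeasurable => w; rewrite lee_fin; first exact: fraction_ge0.
rewrite big_cons big_map sumI mul1r !indicE.
have [Dw|nDw] := pselect (D w).
  by rewrite (mem_set Dw) memNset ?add0r ?mul1r//; exact.
by rewrite mem_set// (memNset nDw) mul0r addr0 fraction_le1.
Qed.

Lemma expected_degree_fraction_dist m n (p e : R) : (m <= n)%N -> 0 <= p <= 1 ->
  (forall j, (m <= j)%N -> `|mean_fraction j - p| <= e) ->
  `|fine (expected_degree_fraction Y tau k.+1 t) - p| <=
    e + (1 - (pr (arrived m) - pr (arrived n))).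
Proof.
move=> mn /andP[p0 p1] pe.
have := expected_degree_fraction_bounds mn erefl; set s := \sum_(_ <= _ < _) _.
case: (expected_degree_fraction _ _ _ _) => [x| |]; last first.
- by rewrite leeNy_eq.
- by rewrite leye_eq andbF.
rewrite !lee_fin /= => /andP[sx xs].
have [e0 d0] : 0 <= e /\ forall j, 0 <= pr (arrived j) - pr (arrived j.+1).
  split; first exact: le_trans (pe m (leqnn m)).
  by move=> j; rewrite -pr_between// pr_ge0.
have sum_d : \sum_(m <= j < n) (pr (arrived j) - pr (arrived j.+1)) =
    pr (arrived m) - pr (arrived n).
  rewrite (telescope_sumr_eq (fun j => - pr (arrived j)))//.
    by rewrite opprK addrC.
  by move=> j _; rewrite opprK addrC.
set r := pr (arrived m) - pr (arrived n) in xs sum_d *.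
have r0 : 0 <= r by rewrite -sum_d sumr_ge0.
have r1 : r <= 1.
  by rewrite /r -pr_between// pr_le1.
have s_le : s <= r * (p + e).
  rewrite -sum_d mulr_suml; apply: ler_sum_nat => j /andP[mj _]; rewrite ler_wpM2l//.
  by have := pe _ mj; rewrite ler_distl => /andP[].
have s_ge : r * (p - e) <= s.
  rewrite -sum_d mulr_suml; apply: ler_sum_nat => j /andP[mj _]; rewrite ler_wpM2l//.
  by have := pe _ mj; rewrite ler_distl => /andP[].
(* A mass [r] has mean within [e] of [p]; the remaining mass 1 - r contributes an error of at most 1
   - r. *)
by rewrite ler_distl; apply/andP; split; nra.
Qed.

End ObservationTime.

(** * Passage to the limit in time *)

Lemma cvg_mean_fraction k : mean_fraction k @ \oo --> degree_law k.+1.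
Proof.
apply: (cvg_degree_law
  (e := fun n k => iter n growth (degree_count k) single_edge)).
by move=> n j; exact: iter_growth_step_degree_count.
Qed.

Lemma pr_arrival_small (t e : R) : 0 < e ->
  exists N, forall n, (N <= n)%N -> pr [set w | arrival_time tau n w <= t] <= e.
Proof.
move=> e0; pose c := expR (8 * lambda * t) * 2.
have c0 : 0 < c by rewrite mulr_gt0 ?expR_gt0.
exists (Num.truncn (c / e)) => n Nn; rewrite (le_trans (pr_arrival_le n t))//.
rewrite mulrA -/c ler_pdivrMr// mulrC -ler_pdivrMr//.
apply: le_trans (ltW (truncnS_gt (c / e))) _; rewrite ler_nat ltnS.
exact: leq_trans (leqnSn _).
Qed.

Lemma cvg_expected_degree_fraction k :
  expected_degree_fraction Y tau k.+1 t @[t --> +oo%R] --> (degree_law k.+1)%:E.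
Proof.
have [p0 p1] : 0 <= degree_law k.+1 :> R /\ degree_law k.+1 <= 1 :> R.
  split; first by rewrite divr_ge0// !mulr_ge0.
  rewrite ler_pdivrMr ?mulr_gt0// mul1r -!natrM ler_nat.
  by rewrite (leq_trans (_ : 4 <= 1 * 2 * 3)%N)// !leq_mul.
(* With [m] and [n] both 0 the sum is empty, and the bounds read 0 and 1. *)
have fin t : expected_degree_fraction Y tau k.+1 t \is a fin_num.
  have /andP[] := expected_degree_fraction_bounds (t := t) (k := k) (leqnn 0) erefl.
  by case: (expected_degree_fraction _ _ _ _).
have -> : expected_degree_fraction Y tau k.+1 =
    EFin \o (fun t => fine (expected_degree_fraction Y tau k.+1 t)).
  by apply/funext => t; rewrite /= fineK.
apply: cvg_EFin; first by apply: nearW.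
apply/cvgrPdistC_le => e e0; have e3 : 0 < e / 3 by rewrite divr_gt0.
have /cvgrPdistC_le/(_ _ e3)[m _ me] := @cvg_mean_fraction k.
have mT : measurable_fun [set: Omega] (arrival_time tau m).
  by move=> _ B mB; rewrite setTI; exact: measurable_arrival_time.
pose T : {RV P >-> R} := mfun_Sub (mem_set mT).
have /cvgrPdist_le/(_ _ e3) near1 := cvg_pr_le T.
(* Order of choices: [m] comes from the mean fractions, then [t] is large enough for [m] arrivals to
   be likely, and [N], depending on [t], makes [N] arrivals unlikely. *)
near=> t; have [N hN] := pr_arrival_small t e3.
have hT : `|1 - pr [set w | arrival_time tau m w <= t]| <= e / 3.
  by near: t.
have p01 : 0 <= (degree_law k.+1 : R) <= 1 by rewrite p0.
have := expected_degree_fraction_dist t (leq_maxl m N) p01 me.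
move/le_trans; apply; have := hN _ (leq_maxr m N).
by move: hT; rewrite ler_norml => /andP[_]; lra.
Unshelve. all: by end_near. Qed.

End Trajectory.

Theorem theorem2 (R : realType) (lambda : R) (hlambda : 0 < lambda)
  (d : measure_display) (Omega : measurableType d) (P : probability Omega R)
  (Y : nat -> Omega -> graph) (tau : nat -> {RV P >-> R})
  (hY : MC_process Y tau lambda 1 1 +oo%E +oo%E) :
  exists p : nat -> R,
    (forall k : nat, (1 <= k)%N ->
       expected_degree_fraction Y tau k t @[t --> +oo%R] --> (p k)%:E) /\
    power_law p.
Proof.
exists degree_law; split; last exact: power_law_degree_law.
by case=> // k _; exact: (cvg_expected_degree_fraction hlambda hY).
Qed.
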